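(* Let $X$ be an $E$-synthetic spectrum, let $n,s\in\mathbf Z$ and $k\ge1$. Let $Z_r^{n,s}$ and $B_r^{n,s}$ denote the $r$-cycles and $r$-boundaries in the signature spectral sequence of $X$, with $Z_1=E_2$ and $B_1=0$. (1) Suppose that for every $1\le i\le k$ we have a collection of elements $\{\beta^i_j\}_j\subseteq\pi_{n,\,s+k-i}(X/\tau^i)$ whose images under $X/\tau^i\to X/\tau$ generate the abelian group $$Z_i^{n,\,s+k-i}/B_{k+1-i}^{n,\,s+k-i}.$$ Let $\alpha^i_j\in\pi_{n,s}(X/\tau^k)$ be the image of $\beta^i_j$ under the map $\tau^{k-i}\colon\Sigma^{0,-k+i}X/\tau^i\to X/\tau^k$. Then $\{\alpha^i_j\}_{i,j}$ generates the abelian group $\pi_{n,s}(X/\tau^k)$. (2) Let $1\le m\le k$. Suppose that for every $1\le i\le k-m$ we have a collection of elements $\{\beta^i_j\}_j\subseteq\pi_{n,\,s+k-i}(X/\tau^i)$ whose images under $X/\tau^i\to X/\tau$ generate $Z_i^{n,\,s+k-i}/B_{k+1-i}^{n,\,s+k-i}$, and let $\alpha^i_j\in\pi_{n,s}(X/\tau^k)$ be the image of $\beta^i_j$ under $\tau^{k-i}$. Then $\{\alpha^i_j\}_{i,j}$ generates the abelian group $\ker\big(\pi_{n,s}(X/\tau^k)\to\pi_{n,s}(X/\tau^m)\big)$.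
   Context: $E$ is a homotopy-associative ring spectrum of Adams type, and $\mathrm{Syn}_E$ is Pstrągowski's $\infty$-category of $E$-synthetic spectra with synthetic analogue functor $\nu$. Bigraded spheres are $\mathbf S^{n,s}=\Sigma^{-s}\nu(\mathbf S^{n+s})$, $\pi_{n,s}(X)=[\mathbf S^{n,s},X]$, $\Sigma^{n,s}X=\mathbf S^{n,s}\otimes X$, and $\tau\colon\mathbf S^{0,-1}\to\mathbf S^{0,0}$ is the canonical map; $X/\tau^k$ is the cofibre of $\tau^k\colon\Sigma^{0,-k}X\to X$. The signature of $X$ is the filtered spectrum $\cdots\xrightarrow{\tau}\mathrm{map}(\mathbf S,\Sigma^{0,-1}X)\xrightarrow{\tau}\mathrm{map}(\mathbf S,X)\xrightarrow{\tau}\mathrm{map}(\mathbf S,\Sigma^{0,1}X)\to\cdots$; its associated spectral sequence, the signature spectral sequence of $X$, is indexed as $E_2^{n,s}=\pi_{n,s}(X/\tau)\Rightarrow\pi_nX[\tau^{-1}]$ with $d_r$ of bidegree $(-1,r)$, $r\ge2$. Here $Z_r^{n,s}\subseteq E_2^{n,s}$ is the subgroup of elements on which $d_2,\dots,d_r$ vanish, and $B_r^{n,s}\subseteq E_2^{n,s}$ the subgroup of elements killed by the differentials $d_2,\dots,d_r$ (i.e. representing boundaries of these), so that $B_r\subseteq Z_{r'}$ for all $r,r'$. The image of $\pi_{n,s}(X/\tau^i)\to\pi_{n,s}(X/\tau)$ is $Z_i^{n,s}$. *)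

(* Defs.v *)
(* Homotopy categories of stable oo-categories are treated as tensor
   triangulated categories.  The oo-category of E-synthetic spectra enters
   through the structure on its homotopy category described by
   [synthetic_theory]; the ring spectrum E occurs only as a means to produce
   such a structure, so everything below is stated for an arbitrary one. *)
From mathcomp Require Import all_boot all_order all_algebra.

Set Implicit Arguments.
Unset Strict Implicit.
Unset Printing Implicit Defensive.

Import GRing.Theory.
Local Open Scope ring_scope.

Record additive_category := AdditiveCategory {
  ob :> Type;
  mor : ob -> ob -> zmodType;
  idm : forall A : ob, mor A A;
  compo : forall A B C : ob, mor B C -> mor A B -> mor A C;
  comp_assoc : forall (A B C D : ob) (h : mor C D) (g : mor B C) (f : mor A B),
    compo h (compo g f) = compo (compo h g) f;
  comp_idl : forall (A B : ob) (f : mor A B), compo (idm B) f = f;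
  comp_idr : forall (A B : ob) (f : mor A B), compo f (idm A) = f;
  comp_addl : forall (A B C : ob) (g g' : mor B C) (f : mor A B),
    compo (g + g') f = compo g f + compo g' f;
  comp_addr : forall (A B C : ob) (g : mor B C) (f f' : mor A B),
    compo g (f + f') = compo g f + compo g f';
  zero_ob : exists Z : ob, idm Z = 0;
  biproducts : forall A B : ob, exists (P : ob)
      (i1 : mor A P) (i2 : mor B P) (p1 : mor P A) (p2 : mor P B),
    [/\ compo p1 i1 = idm A, compo p2 i2 = idm B, compo p1 i2 = 0,
        compo p2 i1 = 0 & compo i1 p1 + compo i2 p2 = idm P]
}.

Arguments mor {_} _ _.
Arguments idm {_} _.
Arguments compo {_ _ _ _} _ _.
Notation "g '\oc' f" := (compo g f) (at level 40, left associativity).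

Record iso (C : additive_category) (A B : C) := Iso {
  iso_to : mor A B;
  iso_of : mor B A;
  iso_toK : iso_of \oc iso_to = idm A;
  iso_ofK : iso_to \oc iso_of = idm B
}.

Lemma id_isoP (C : additive_category) (A : C) : idm A \oc idm A = idm A.
Proof. exact: comp_idl. Qed.

Definition eq_iso (C : additive_category) (I : Type) (F : I -> C) (i j : I)
    (e : i = j) : iso (F i) (F j) :=
  match e in _ = j' return iso (F i) (F j') with
  | erefl => Iso (id_isoP (F i)) (id_isoP (F i))
  end.

Lemma comp_isoP (C : additive_category) (A B D : C) (u : iso A B) (v : iso B D) :
  (iso_of u \oc iso_of v) \oc (iso_to v \oc iso_to u) = idm A.
Proof.
by rewrite comp_assoc -(comp_assoc (iso_of u)) iso_toK comp_idr iso_toK.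
Qed.

Lemma comp_isoP' (C : additive_category) (A B D : C) (u : iso A B) (v : iso B D) :
  (iso_to v \oc iso_to u) \oc (iso_of u \oc iso_of v) = idm D.
Proof.
by rewrite comp_assoc -(comp_assoc (iso_to v)) iso_ofK comp_idr iso_ofK.
Qed.

Definition comp_iso (C : additive_category) (A B D : C) (u : iso A B)
    (v : iso B D) : iso A D :=
  Iso (comp_isoP u v) (comp_isoP' u v).

(* [susp] is an autoequivalence: it is bijective on morphisms, and [desusp]
   provides a preimage of every object. *)
Record triangulated_category := TriangulatedCategory {
  tr_cat :> additive_category;
  susp : tr_cat -> tr_cat;
  suspm : forall A B : tr_cat, mor A B -> mor (susp A) (susp B);
  suspm_id : forall A : tr_cat, suspm (idm A) = idm (susp A);
  suspm_comp : forall (A B C : tr_cat) (g : mor B C) (f : mor A B),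
    suspm (g \oc f) = suspm g \oc suspm f;
  suspm_add : forall (A B : tr_cat) (f g : mor A B),
    suspm (f + g) = suspm f + suspm g;
  suspm_bij : forall A B : tr_cat, bijective (@suspm A B);
  desusp : tr_cat -> tr_cat;
  desuspK : forall A : tr_cat, iso (susp (desusp A)) A;
  dist : forall A B C : tr_cat,
    mor A B -> mor B C -> mor C (susp A) -> Prop;
  dist_id : forall A Z : tr_cat, idm Z = 0 ->
    dist (idm A) (0 : mor A Z) (0 : mor Z (susp A));
  dist_complete : forall (A B : tr_cat) (f : mor A B),
    exists (C : tr_cat) (g : mor B C) (h : mor C (susp A)), dist f g h;
  dist_iso : forall (A B C A' B' C' : tr_cat)
      (f : mor A B) (g : mor B C) (h : mor C (susp A))
      (f' : mor A' B') (g' : mor B' C') (h' : mor C' (susp A'))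
      (a : iso A A') (b : iso B B') (c : iso C C'),
    iso_to b \oc f = f' \oc iso_to a ->
    iso_to c \oc g = g' \oc iso_to b ->
    suspm (iso_to a) \oc h = h' \oc iso_to c ->
    dist f g h -> dist f' g' h';
  dist_rotate : forall (A B C : tr_cat)
      (f : mor A B) (g : mor B C) (h : mor C (susp A)),
    dist f g h <-> dist g h (- suspm f);
  dist_morphism : forall (A B C A' B' C' : tr_cat)
      (f : mor A B) (g : mor B C) (h : mor C (susp A))
      (f' : mor A' B') (g' : mor B' C') (h' : mor C' (susp A'))
      (a : mor A A') (b : mor B B'),
    dist f g h -> dist f' g' h' -> b \oc f = f' \oc a ->
    exists c : mor C C', c \oc g = g' \oc b /\ suspm a \oc h = h' \oc c;
  dist_octahedron : forall (A B C D E F : tr_cat) (f : mor A B) (g : mor B C)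
      (p : mor B D) (d : mor D (susp A))
      (q : mor C E) (e : mor E (susp A))
      (r : mor C F) (x : mor F (susp B)),
    dist f p d -> dist (g \oc f) q e -> dist g r x ->
    exists (u : mor D E) (v : mor E F),
      [/\ dist u v (suspm p \oc x), u \oc p = q \oc g, e \oc u = d,
          v \oc q = r & x \oc v = suspm f \oc e]
}.

(* A symmetric monoidal structure that is exact in each variable (exactness in
   the first variable follows from the symmetry). *)
Record tt_category := TTCategory {
  tt_cat :> triangulated_category;
  tens : tt_cat -> tt_cat -> tt_cat;
  tensm : forall A A' B B' : tt_cat,
    mor A A' -> mor B B' -> mor (tens A B) (tens A' B');
  tensm_id : forall A B : tt_cat, tensm (idm A) (idm B) = idm (tens A B);
  tensm_comp : forall (A A' A'' B B' B'' : tt_cat)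
      (f' : mor A' A'') (f : mor A A') (g' : mor B' B'') (g : mor B B'),
    tensm (f' \oc f) (g' \oc g) = tensm f' g' \oc tensm f g;
  tensm_addl : forall (A A' B B' : tt_cat) (f f' : mor A A') (g : mor B B'),
    tensm (f + f') g = tensm f g + tensm f' g;
  tensm_addr : forall (A A' B B' : tt_cat) (f : mor A A') (g g' : mor B B'),
    tensm f (g + g') = tensm f g + tensm f g';
  tt_unit : tt_cat;
  lunit : forall A : tt_cat, iso (tens tt_unit A) A;
  runit : forall A : tt_cat, iso (tens A tt_unit) A;
  associator : forall A B C : tt_cat,
    iso (tens (tens A B) C) (tens A (tens B C));
  braid : forall A B : tt_cat, iso (tens A B) (tens B A);
  lunit_nat : forall (A B : tt_cat) (f : mor A B),
    iso_to (lunit B) \oc tensm (idm tt_unit) f = f \oc iso_to (lunit A);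
  runit_nat : forall (A B : tt_cat) (f : mor A B),
    iso_to (runit B) \oc tensm f (idm tt_unit) = f \oc iso_to (runit A);
  associator_nat : forall (A A' B B' C C' : tt_cat)
      (f : mor A A') (g : mor B B') (h : mor C C'),
    iso_to (associator A' B' C') \oc tensm (tensm f g) h
      = tensm f (tensm g h) \oc iso_to (associator A B C);
  braid_nat : forall (A A' B B' : tt_cat) (f : mor A A') (g : mor B B'),
    iso_to (braid A' B') \oc tensm f g = tensm g f \oc iso_to (braid A B);
  triangle : forall A B : tt_cat,
    tensm (idm A) (iso_to (lunit B)) \oc iso_to (associator A tt_unit B)
      = tensm (iso_to (runit A)) (idm B);
  pentagon : forall A B C D : tt_cat,
    iso_to (associator A B (tens C D)) \oc iso_to (associator (tens A B) C D)
      = tensm (idm A) (iso_to (associator B C D))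
          \oc iso_to (associator A (tens B C) D)
          \oc tensm (iso_to (associator A B C)) (idm D);
  hexagon : forall A B C : tt_cat,
    iso_to (associator B C A) \oc iso_to (braid A (tens B C))
        \oc iso_to (associator A B C)
      = tensm (idm B) (iso_to (braid A C)) \oc iso_to (associator B A C)
          \oc tensm (iso_to (braid A B)) (idm C);
  braidK : forall A B : tt_cat,
    iso_to (braid B A) \oc iso_to (braid A B) = idm (tens A B);
  tens_susp : forall A B : tt_cat, iso (tens A (susp B)) (susp (tens A B));
  tens_susp_nat : forall (A A' B B' : tt_cat) (f : mor A A') (g : mor B B'),
    iso_to (tens_susp A' B') \oc tensm f (suspm g)
      = suspm (tensm f g) \oc iso_to (tens_susp A B);
  tens_exact : forall (W A B C : tt_cat)
      (f : mor A B) (g : mor B C) (h : mor C (susp A)),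
    dist f g h ->
    dist (tensm (idm W) f) (tensm (idm W) g)
      (iso_to (tens_susp W A) \oc tensm (idm W) h)
}.

(* Sigma^m for an integer m. *)
Definition suspz (C : triangulated_category) (m : int) (A : C) : C :=
  match m with
  | Posz k => iter k (@susp C) A
  | Negz k => iter k.+1 (@desusp C) A
  end.

Lemma PoszS (k : nat) : Posz k.+1 = Posz k + 1.
Proof. by rewrite -PoszD addn1. Qed.

Lemma NegzS (k : nat) : Negz k = Negz k.+1 + 1.
Proof. by rewrite !NegzE -[in RHS]addn1 PoszD opprD addrNK. Qed.

Definition suspz_succ (C : triangulated_category) (m : int) (A : C) :
    iso (susp (suspz m A)) (suspz (m + 1) A) :=
  match m return iso (susp (suspz m A)) (suspz (m + 1) A) with
  | Posz k => eq_iso (fun m => suspz m A) (PoszS k)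
  | Negz 0 => desuspK A
  | Negz k.+1 =>
      comp_iso (desuspK (suspz (Negz k) A))
        (eq_iso (fun m => suspz m A) (NegzS k))
  end.

(* [Sp] and [Syn] stand for the homotopy categories of spectra and of
   E-synthetic spectra and [nu] for the synthetic analogue.  [nu_susp] is the
   comparison map Sigma (nu P) -> nu (Sigma P), which need not be invertible.
   [sphere_mul] is S^{n,s} (x) S^{n',s'} ~ S^{n+n',s+s'}; no coherence is
   required of it, so the results hold for every choice of these (classically
   implicit) identifications. *)
Record synthetic_theory := SyntheticTheory {
  Sp : tt_category;
  Syn :> tt_category;
  nu : Sp -> Syn;
  num : forall P Q : Sp, mor P Q -> mor (nu P) (nu Q);
  num_id : forall P : Sp, num (idm P) = idm (nu P);
  num_comp : forall (P Q R : Sp) (g : mor Q R) (f : mor P Q),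
    num (g \oc f) = num g \oc num f;
  nu_unit : iso (nu (tt_unit Sp)) (tt_unit Syn);
  nu_susp : forall P : Sp, mor (susp (nu P)) (nu (susp P));
  nu_susp_nat : forall (P Q : Sp) (f : mor P Q),
    nu_susp Q \oc suspm (num f) = num (suspm f) \oc nu_susp P;
  sphere_mul :
    let S (n s : int) : Syn := suspz (- s) (nu (suspz (n + s) (tt_unit Sp))) in
    forall n s n' s' : int, iso (tens (S n s) (S n' s')) (S (n + n') (s + s'))
}.

Section Synthetic.
Variable T : synthetic_theory.

(* S^{n,s} = Sigma^{-s} nu(S^{n+s}) *)
Definition sphere (n s : int) : T :=
  suspz (- s) (nu (suspz (n + s) (tt_unit (Sp T)))).

(* pi_{n,s}(Y) = [S^{n,s}, Y] *)
Definition hpi (n s : int) (Y : T) : zmodType := mor (sphere n s) Y.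

(* Sigma nu(S^{-1}) -> nu(Sigma S^{-1}) = nu(S^0), followed by the
   identification of nu(S^0) with the unit. *)
Definition tau : mor (sphere 0 (-1)) (tt_unit T) :=
  iso_to (nu_unit T) \oc num (iso_to (desuspK (tt_unit (Sp T))))
    \oc nu_susp (desusp (tt_unit (Sp T))).

(* Sigma^{0,-c} Y, with S^{0,-c} taken to be the c-th tensor power of
   S^{0,-1}. *)
Fixpoint down (c : nat) (Y : T) : T :=
  if c is c'.+1 then tens (sphere 0 (-1)) (down c' Y) else Y.

Fixpoint downm (c : nat) (Y Z : T) (f : mor Y Z) : mor (down c Y) (down c Z) :=
  if c is c'.+1 then tensm (idm (sphere 0 (-1))) (downm c' f) else f.

Definition tau_on (Y : T) : mor (down 1 Y) Y :=
  iso_to (lunit Y) \oc tensm tau (idm Y).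

(* tau^{k-m} : Sigma^{0,-k} Y -> Sigma^{0,-m} Y for m <= k; the value for
   k < m is a dummy. *)
Fixpoint tau_pow (k m : nat) (Y : T) : mor (down k Y) (down m Y) :=
  match k, m return mor (down k Y) (down m Y) with
  | k'.+1, m'.+1 => tensm (idm (sphere 0 (-1))) (tau_pow k' m' Y)
  | k'.+1, 0 => tau_pow k' 0 Y \oc tau_on (down k' Y)
  | 0, 0 => idm Y
  | 0, _.+1 => 0
  end.

(* Sigma^{0,-c} Sigma^{0,-i} Y ~ Sigma^{0,-(c+i)} Y *)
Fixpoint down_add (c i : nat) (Y : T) :
    mor (down c (down i Y)) (down (c + i) Y) :=
  match c return mor (down c (down i Y)) (down (c + i) Y) with
  | 0 => idm (down i Y)
  | c'.+1 => tensm (idm (sphere 0 (-1))) (down_add c' i Y)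
  end.

Fixpoint down_susp (c : nat) (Y : T) : mor (down c (susp Y)) (susp (down c Y)) :=
  match c return mor (down c (susp Y)) (susp (down c Y)) with
  | 0 => idm (susp Y)
  | c'.+1 => iso_to (tens_susp (sphere 0 (-1)) (down c' Y))
               \oc tensm (idm (sphere 0 (-1))) (down_susp c' Y)
  end.

(* The diagram that the tower of the Sigma^{0,-k} X determines in a stable
   oo-category: the cofibres X/tau^k, the reductions X/tau^k -> X/tau^m, the
   multiplications tau^c : Sigma^{0,-c} X/tau^i -> X/tau^(c+i), and for all
   c, i the octahedron of the composite
     Sigma^{0,-(c+i)} X -> Sigma^{0,-c} X -> X,
   compatibly with each other.  Functoriality of cofibres is not available in a
   bare triangulated category, so these canonical maps are kept as data. *)
Record tau_quotients (X : T) := TauQuotients {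
  quo : nat -> T;
  quo_in : forall k, mor X (quo k);
  quo_bd : forall k, mor (quo k) (susp (down k X));
  quo_red : forall k m, (m <= k)%N -> mor (quo k) (quo m);
  quo_mul : forall c i k, (c + i)%N = k -> mor (down c (quo i)) (quo k);
  quo_dist : forall k, dist (tau_pow k 0 X) (quo_in k) (quo_bd k);
  quo_red_id : forall k (h : (k <= k)%N), quo_red h = idm (quo k);
  quo_red_comp : forall k m l (h : (m <= k)%N) (h' : (l <= m)%N)
      (h'' : (l <= k)%N), quo_red h' \oc quo_red h = quo_red h'';
  quo_mul_id : forall k (e : (0 + k)%N = k), quo_mul e = idm (quo k);
  quo_mul_comp : forall c c' i k l (e : (c + i)%N = k) (e' : (c' + k)%N = l)
      (e'' : (c' + c + i)%N = l),
    quo_mul e' \oc downm c' (quo_mul e)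
      = quo_mul e'' \oc down_add c' c (quo i);
  quo_red_in : forall k m (h : (m <= k)%N), quo_red h \oc quo_in k = quo_in m;
  quo_red_bd : forall k m (h : (m <= k)%N),
    quo_bd m \oc quo_red h = suspm (tau_pow k m X) \oc quo_bd k;
  quo_mul_in : forall c i k (e : (c + i)%N = k),
    quo_mul e \oc downm c (quo_in i) = quo_in k \oc tau_pow c 0 X;
  quo_mul_bd : forall c i,
    quo_bd (c + i) \oc quo_mul (erefl (c + i)%N)
      = suspm (down_add c i X) \oc down_susp c (down i X)
          \oc downm c (quo_bd i);
  quo_mul_dist : forall c i k (e : (c + i)%N = k) (h : (c <= k)%N),
    dist (quo_mul e) (quo_red h) (suspm (downm c (quo_in i)) \oc quo_bd c);
  quo_red_mul : forall c i j k l (e : (c + i)%N = k) (e' : (c + j)%N = l)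
      (h : (j <= i)%N) (h' : (l <= k)%N),
    quo_red h' \oc quo_mul e = quo_mul e' \oc downm c (quo_red h)
}.

Lemma sphere_downE (n s : int) : (n, s) = (0 + n, -1 + (s + 1)).
Proof. by rewrite add0r addrC addrK. Qed.

(* S^{n,s} ~ Sigma^{0,-1} S^{n,s+1} *)
Definition sphere_down (n s : int) :
    mor (sphere n s) (down 1 (sphere n (s + 1))) :=
  iso_of (sphere_mul T 0 (-1) n (s + 1))
    \oc iso_to (eq_iso (fun d => sphere d.1 d.2) (sphere_downE n s)).

Lemma sphere_suspE (n s n' s' : int) : n' = n - 1 -> s' = s + 1 ->
  (- s, n + s) = (- s' + 1, n' + s').
Proof. by move=> -> ->; rewrite opprD addrNK (addrC s) addrA addrNK. Qed.

(* S^{n,s} ~ Sigma S^{n-1,s+1} *)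
Definition sphere_susp (n s n' s' : int) (en : n' = n - 1) (es : s' = s + 1) :
    mor (sphere n s) (susp (sphere n' s')) :=
  iso_of (suspz_succ (- s') (nu (suspz (n' + s') (tt_unit (Sp T)))))
    \oc iso_to (eq_iso (fun d => suspz d.1 (nu (suspz d.2 (tt_unit (Sp T)))))
                 (sphere_suspE en es)).

Lemma down_pi0 (s s' : int) : s' = s + 0%N%:Z -> s = s'.
Proof. by move=> ->; rewrite addr0. Qed.

Lemma down_piS (c : nat) (s s' : int) :
  s' = s + c.+1%:Z -> s' = s + 1 + c%:Z.
Proof. by move=> ->; rewrite -addrA -PoszD add1n. Qed.

(* pi_{n,s+c}(Y) ~ pi_{n,s}(Sigma^{0,-c} Y) *)
Fixpoint down_pi (c : nat) (n s s' : int) (Y : T) :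
    s' = s + c%:Z -> hpi n s' Y -> hpi n s (down c Y) :=
  match c return s' = s + c%:Z -> hpi n s' Y -> hpi n s (down c Y) with
  | 0 => fun e f => f \oc iso_to (eq_iso (sphere n) (down_pi0 e))
  | c'.+1 => fun e f =>
      tensm (idm (sphere 0 (-1))) (down_pi (down_piS e) f) \oc sphere_down n s
  end.

(* pi_{n-1,s+1}(Y) ~ pi_{n,s}(Sigma Y) *)
Definition susp_pi (n s n' s' : int) (Y : T) (en : n' = n - 1)
    (es : s' = s + 1) (f : hpi n' s' Y) : hpi n s (susp Y) :=
  suspm f \oc sphere_susp en es.

Section Signature.
Variables (X : T) (Q : tau_quotients X).

(* [differential r x y]: for r >= 1, the class of y in E_{r+1}^{n-1,s+r+1} is a
   value of d_{r+1} on the class of x in E_{r+1}^{n,s}.  As for every filtered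
   object, this means that the boundary of x in pi_{n-1}(Sigma^{0,-1} X) is the
   image under tau^(r-1) of an element a of pi_{n-1}(Sigma^{0,-r} X) that
   represents y. *)
Definition differential (r : nat) (n s n' s' : int)
    (x : hpi n s (quo Q 1)) (y : hpi n' s' (quo Q 1)) : Prop :=
  exists (en : n' = n - 1) (es : s' = s + 1 + r%:Z) (a : hpi n' s' X),
    quo_bd Q 1 \oc x
      = susp_pi en (erefl (s + 1)) (tau_pow r 1 X \oc down_pi es a)
    /\ y = quo_in Q 1 \oc a.

(* The pair (Z_r, B_r), both as subgroups of E_2 = pi_{*,*}(X/tau).  Passing
   from r to r+1, a cycle is an r-cycle on which d_{r+1} vanishes in
   Z_r/B_r, and a boundary is an element of E_2 whose class modulo B_r is
   a value of d_{r+1}. *)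
Fixpoint cycles_boundaries (r : nat) :
    (forall n s : int, hpi n s (quo Q 1) -> Prop)
    * (forall n s : int, hpi n s (quo Q 1) -> Prop) :=
  if r is r'.+1 then
    if r' is 0 then (fun _ _ _ => True, fun _ _ y => y = 0) else
    let ZB := cycles_boundaries r' in
    (fun n s x => ZB.1 n s x /\
       exists y : hpi (n - 1) (s + r'.+1%:Z) (quo Q 1),
         differential r' x y /\ ZB.2 _ _ y,
     fun n s y =>
       exists (x : hpi (n + 1) (s - r'.+1%:Z) (quo Q 1)) (z : hpi n s (quo Q 1)),
         [/\ ZB.1 _ _ x, differential r' x z & ZB.2 _ _ (y - z)])
  else (fun _ _ _ => True, fun _ _ y => y = 0).

Definition cycles (r : nat) (n s : int) : hpi n s (quo Q 1) -> Prop :=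
  (cycles_boundaries r).1 n s.

Definition boundaries (r : nat) (n s : int) : hpi n s (quo Q 1) -> Prop :=
  (cycles_boundaries r).2 n s.

Lemma tau_mul_deg (i k : nat) (s : int) : (i <= k)%N ->
  s + k%:Z - i%:Z = s + (k - i)%N%:Z.
Proof. by move=> h; rewrite -subzn // addrA. Qed.

(* tau^(k-i) : pi_{n,s+k-i}(X/tau^i) -> pi_{n,s}(X/tau^k) *)
Definition tau_mul (i k : nat) (h : (i <= k)%N) (n s : int)
    (b : hpi n (s + k%:Z - i%:Z) (quo Q i)) : hpi n s (quo Q k) :=
  quo_mul Q (subnK h) \oc down_pi (tau_mul_deg s h) b.

End Signature.
End Synthetic.

Definition is_subgroup (M : zmodType) (H : M -> Prop) : Prop :=
  H 0 /\ forall x y : M, H x -> H y -> H (x - y).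

Definition zspan (M : zmodType) (S : M -> Prop) (x : M) : Prop :=
  forall H : M -> Prop, is_subgroup H -> (forall y, S y -> H y) -> H x.

Definition generates (M : zmodType) (A S : M -> Prop) : Prop :=
  forall x : M, A x <-> zspan S x.

(* The elements of S lie in Z and their classes generate Z/B. *)
Definition generates_mod (M : zmodType) (Z B S : M -> Prop) : Prop :=
  (forall x : M, S x -> Z x) /\
  (forall z : M, Z z -> exists w : M, zspan S w /\ B (z - w)).

(* Main.v *)
(* An element of the kernel of pi(X/tau^k) -> pi(X/tau^(k-l)) is tau^(k-l) y for
   some y in pi(X/tau^l).  The image of y in pi(X/tau) is an l-cycle, hence a
   combination of the given generators up to an element of B_(k-l+1).  Such a
   boundary is the reduction of some a in pi(X) with tau^(k-l) a = 0, so that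
   subtracting the image of a from y does not change tau^(k-l) y.  After
   subtracting the generators and a, the element y reduces to 0 in X/tau, hence
   tau^(k-l) y reduces to 0 in X/tau^(k-l+1), and one concludes by induction
   on l. *)
Require Import Defs.
From mathcomp Require Import all_boot all_order all_algebra.

Set Implicit Arguments.
Unset Strict Implicit.
Unset Printing Implicit Defensive.

Import GRing.Theory.
Local Open Scope ring_scope.

(** * Exactness in triangulated categories *)

Section Additive.
Variable C : additive_category.

Lemma comp0l (A B D : C) (f : mor A B) : (0 : mor B D) \oc f = 0.
Proof. by apply: (addrI (0 \oc f)); rewrite -comp_addl !addr0. Qed.

Lemma comp0r (A B D : C) (g : mor B D) : g \oc (0 : mor A B) = 0.
Proof. by apply: (addrI (g \oc 0)); rewrite -comp_addr !addr0. Qed.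

Lemma compNr (A B D : C) (g : mor B D) (f : mor A B) : g \oc (- f) = - (g \oc f).
Proof. by apply: (addrI (g \oc f)); rewrite -comp_addr !addrN comp0r. Qed.

Lemma compNl (A B D : C) (g : mor B D) (f : mor A B) : (- g) \oc f = - (g \oc f).
Proof. by apply: (addrI (g \oc f)); rewrite -comp_addl !addrN comp0l. Qed.

Lemma compBr (A B D : C) (g : mor B D) (f f' : mor A B) :
  g \oc (f - f') = g \oc f - g \oc f'.
Proof. by rewrite comp_addr compNr. Qed.

Lemma iso_injl (A B D : C) (u : iso B D) (f g : mor A B) :
  iso_to u \oc f = iso_to u \oc g -> f = g.
Proof.
by move=> e; rewrite -(comp_idl f) -(comp_idl g) -(iso_toK u) -!comp_assoc e.
Qed.

Lemma iso_injr (A B D : C) (u : iso A B) (f g : mor B D) :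
  f \oc iso_to u = g \oc iso_to u -> f = g.
Proof.
by move=> e; rewrite -(comp_idr f) -(comp_idr g) -(iso_ofK u) !comp_assoc e.
Qed.

Definition inv_iso (A B : C) (u : iso A B) : iso B A :=
  Iso (iso_ofK u) (iso_toK u).

End Additive.

Section Triangulated.
Variable C : triangulated_category.

Lemma suspm0 (A B : C) : suspm (0 : mor A B) = 0.
Proof. by apply: (addrI (suspm 0)); rewrite -suspm_add !addr0. Qed.

Lemma suspm_inj (A B : C) : injective (@suspm C A B).
Proof. exact: bij_inj (suspm_bij A B). Qed.

Lemma suspm_surj (A B : C) (g : mor (susp A) (susp B)) :
  exists f : mor A B, suspm f = g.
Proof. by have [h _ hK] := suspm_bij A B; exists (h g). Qed.

Section Dist.
Variables (A B D : C) (f : mor A B) (g : mor B D) (h : mor D (susp A)).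
Hypothesis dfgh : dist f g h.

(** The triangle on [idm A] with third term a zero object maps to the given one by [idm A] and [f];
    commutativity of the fill-in square writes [g \oc f] as a composite with 0. *)
Lemma dist_comp0 : g \oc f = 0.
Proof.
have [Z Z0] := zero_ob C.
have [c [<- _]] := dist_morphism (dist_id A Z0) dfgh
  (erefl : f \oc idm A = f \oc idm A).
exact: comp0r.
Qed.

(** The rotated triangle on [idm S] maps to the rotation of the given one by [x] and 0. Its fill-in
    is a map of suspensions, and [suspm], being bijective on morphisms, brings it back to the
    required [a]. *)
Lemma dist_exact (S : C) (x : mor S B) :
  g \oc x = 0 -> exists a : mor S A, f \oc a = x.
Proof.
move=> gx0; have [Z Z0] := zero_ob C.
have /dist_rotate dS := dist_id S Z0.
have dfgh' := dfgh; move/dist_rotate: dfgh' => dR.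
have e : (0 : mor Z D) \oc (0 : mor S Z) = g \oc x by rewrite comp0l gx0.
have [c [_]] := dist_morphism dS dR e.
have [a <-] := suspm_surj c.
rewrite compNr compNl -!suspm_comp comp_idr => /oppr_inj /suspm_inj ->.
by exists a.
Qed.

End Dist.

Lemma dist_susp_comp0 (A B D : C) (f : mor A B) (g : mor B D)
    (h : mor D (susp A)) : dist f g h -> suspm f \oc h = 0.
Proof.
move=> /dist_rotate /dist_rotate /dist_comp0.
by rewrite compNl => /eqP; rewrite oppr_eq0 => /eqP.
Qed.

End Triangulated.

(** * Unit coherence and invertible objects *)

Section TensorTriangulated.
Variable C : tt_category.
Local Notation I := (tt_unit C).
Local Notation "f '\ox' g" := (tensm f g) (at level 30, right associativity).

Lemma tensm0r (A B D E : C) (f : mor A B) : f \ox (0 : mor D E) = 0.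
Proof. by apply: (addrI (f \ox 0)); rewrite -tensm_addr !addr0. Qed.

Lemma tensm_compl (W A B D : C) (g : mor B D) (f : mor A B) :
  idm W \ox (g \oc f) = (idm W \ox g) \oc (idm W \ox f).
Proof. by rewrite -tensm_comp comp_idl. Qed.

Lemma tensm_compr (W A B D : C) (g : mor B D) (f : mor A B) :
  (g \oc f) \ox idm W = (g \ox idm W) \oc (f \ox idm W).
Proof. by rewrite -tensm_comp comp_idl. Qed.

Lemma tens_isoP (A A' B B' : C) (u : iso A A') (v : iso B B') :
  (iso_of u \ox iso_of v) \oc (iso_to u \ox iso_to v) = idm _.
Proof. by rewrite -tensm_comp !iso_toK tensm_id. Qed.

Lemma tens_isoP' (A A' B B' : C) (u : iso A A') (v : iso B B') :
  (iso_to u \ox iso_to v) \oc (iso_of u \ox iso_of v) = idm _.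
Proof. by rewrite -tensm_comp !iso_ofK tensm_id. Qed.

Definition tens_iso (A A' B B' : C) (u : iso A A') (v : iso B B') :=
  Iso (tens_isoP u v) (tens_isoP' u v).

Definition id_iso (A : C) : iso A A := Iso (id_isoP A) (id_isoP A).

Lemma tens_unitl_inj (A B : C) (f g : mor A B) :
  idm I \ox f = idm I \ox g -> f = g.
Proof.
by move=> e; apply: (iso_injr (u := lunit A)); rewrite -!lunit_nat e.
Qed.

Lemma tens_unitr_inj (A B : C) (f g : mor A B) :
  f \ox idm I = g \ox idm I -> f = g.
Proof.
by move=> e; apply: (iso_injr (u := runit A)); rewrite -!runit_nat e.
Qed.

(** Kelly's argument: tensoring with the unit is faithful, and after it the identity follows from
    pentagon and triangle. *)
Lemma lunit_tens (A B : C) :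
  iso_to (lunit (tens A B)) \oc iso_to (associator I A B)
    = iso_to (lunit A) \ox idm B.
Proof.
apply: tens_unitl_inj.
apply: (iso_injr (u := associator I (tens I A) B)).
apply: (iso_injr (u := tens_iso (associator I I A) (id_iso B))) => /=.
rewrite -(associator_nat (idm I)) -(comp_assoc _ (_ \ox idm B)) -tensm_compr.
rewrite triangle tensm_compl -!comp_assoc (comp_assoc _ _ (_ \ox idm B)).
by rewrite -pentagon comp_assoc triangle -(tensm_id A B) associator_nat.
Qed.

(** Follows from the hexagon for [A], [I], [I], tested after the faithful functor of tensoring with
    the unit on the right. *)
Lemma lunit_braid (A : C) :
  iso_to (lunit A) \oc iso_to (braid A I) = iso_to (runit A).
Proof.
apply: tens_unitr_inj; apply: (iso_injl (u := braid A I)).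
rewrite tensm_compr -(lunit_tens A) !comp_assoc.
rewrite -lunit_nat -!comp_assoc (comp_assoc (idm I \ox _)) -hexagon.
by rewrite !comp_assoc lunit_tens -braid_nat -triangle !comp_assoc.
Qed.

(* The interchange of the two factors L, by which the two sides differ, need
   not be the identity; only its existence matters below. *)
Lemma unit_map_interchange (L Y : C) (t : mor L I) :
  exists w : mor (tens L (tens L Y)) (tens L (tens L Y)),
    iso_to (lunit (tens L Y)) \oc (t \ox idm (tens L Y))
      = (idm L \ox (iso_to (lunit Y) \oc (t \ox idm Y))) \oc w.
Proof.
exists (iso_to (associator L L Y) \oc (iso_to (braid L L) \ox idm Y)
          \oc iso_of (associator L L Y)).
apply: (iso_injr (u := associator L L Y)).
rewrite -!comp_assoc iso_toK comp_idr -(tensm_id L Y) -associator_nat.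
rewrite comp_assoc lunit_tens -tensm_compr tensm_compl -!comp_assoc.
rewrite (comp_assoc (idm L \ox (t \ox _))) -associator_nat -!comp_assoc.
rewrite (comp_assoc (idm L \ox _)) triangle -!tensm_compr -lunit_braid.
by rewrite -comp_assoc (comp_assoc (iso_to (braid L I))) braid_nat -!comp_assoc
  braidK comp_idr.
Qed.

Definition cancel_iso (L L' : C) (u : iso (tens L' L) I) (A : C) :
    iso (tens L' (tens L A)) A :=
  comp_iso (inv_iso (associator L' L A))
    (comp_iso (tens_iso u (id_iso A)) (lunit A)).

Lemma cancel_iso_nat (L L' : C) (u : iso (tens L' L) I) (A B : C)
    (f : mor A B) :
  iso_to (cancel_iso u B) \oc (idm L' \ox (idm L \ox f))
    = f \oc iso_to (cancel_iso u A).
Proof.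
apply: (iso_injr (u := associator L' L A)) => /=.
rewrite -!comp_assoc iso_toK comp_idr -associator_nat.
rewrite (comp_assoc (iso_of _)) iso_toK comp_idl tensm_id.
by rewrite -tensm_comp comp_idr comp_idl comp_assoc -lunit_nat -comp_assoc
  -tensm_comp comp_idr comp_idl.
Qed.

Lemma invertible_tens_inj (L L' : C) (u : iso (tens L' L) I) (A B : C)
    (f g : mor A B) : idm L \ox f = idm L \ox g -> f = g.
Proof.
by move=> e; apply: (iso_injr (u := cancel_iso u A)); rewrite -!cancel_iso_nat e.
Qed.

(** The preimage is [idm L' \ox h] conjugated by the cancellation isomorphisms. As [L'] is
    invertible too, the equation may be tested after tensoring with it. *)
Lemma invertible_tens_surj (L L' : C) (u : iso (tens L' L) I)
    (v : iso (tens L L') I) (A B : C) (h : mor (tens L A) (tens L B)) :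
  exists f : mor A B, idm L \ox f = h.
Proof.
exists (iso_to (cancel_iso u B) \oc (idm L' \ox h) \oc iso_of (cancel_iso u A)).
apply: (invertible_tens_inj v); apply: (iso_injl (u := cancel_iso u B)).
rewrite cancel_iso_nat; move: (cancel_iso u A) (cancel_iso u B) => a b.
by rewrite -!comp_assoc iso_toK comp_idr.
Qed.

End TensorTriangulated.

(** * Powers of tau and bigraded homotopy *)

Section Synthetic.
Variable T : synthetic_theory.
Local Notation L := (sphere T 0 (-1)).

(** The indices compute, so $S^{0,0}$ is convertible to $\nu$ of the unit. *)
Definition sphere0_iso : iso (sphere T 0 0) (tt_unit T) := nu_unit T.

Definition sphere_invl : iso (tens (sphere T 0 1) L) (tt_unit T) :=
  comp_iso (sphere_mul T 0 1 0 (-1)) sphere0_iso.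

Definition sphere_invr : iso (tens L (sphere T 0 1)) (tt_unit T) :=
  comp_iso (sphere_mul T 0 (-1) 0 1) sphere0_iso.

Lemma downm_comp (c : nat) (A B D : T) (g : mor B D) (f : mor A B) :
  downm c (g \oc f) = downm c g \oc downm c f.
Proof. by elim: c => //= c ->; rewrite tensm_compl. Qed.

Lemma downm0 (c : nat) (A B : T) : downm c (0 : mor A B) = 0.
Proof. by elim: c => //= c ->; rewrite tensm0r. Qed.

Lemma tau_on_nat (A B : T) (f : mor A B) :
  tau_on B \oc tensm (idm L) f = f \oc tau_on A.
Proof.
rewrite /tau_on -comp_assoc -tensm_comp comp_idl comp_idr.
by rewrite comp_assoc -lunit_nat -comp_assoc -tensm_comp comp_idl comp_idr.
Qed.

(** Moves $\tau$ from the outermost factor to the innermost, one interchange of tensor factors at a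
    time. The map [w] is left unspecified, which suffices for deducing that composites vanish. *)
Lemma tau_on_down (c : nat) (A : T) :
  exists w : mor (down c.+1 A) (down c (down 1 A)),
    tau_on (down c A) = downm c (tau_on A) \oc w.
Proof.
elim: c => [|c [w IH]]; first by exists (idm _); rewrite /= comp_idr.
have [v e] := unit_map_interchange (down c A) (tau T).
exists (tensm (idm L) w \oc v).
by rewrite [LHS]e -/(tau_on (down c A)) IH /= tensm_compl comp_assoc.
Qed.

Lemma downm_tau_on0 (c : nat) (A B : T) (g : mor A B) :
  g \oc tau_on A = 0 -> downm c g \oc tau_on (down c A) = 0.
Proof.
have [w ->] := tau_on_down c A; move=> e.
by rewrite comp_assoc -downm_comp e downm0 comp0l.
Qed.

(** [tau_pow] applies the outermost $\tau$ first; naturality of [tau_on] lets it be applied last. *)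
Lemma tau_pow_S (r : nat) (A : T) :
  tau_pow r.+1 0 A = tau_on A \oc tau_pow r.+1 1 A.
Proof. by rewrite /= tau_on_nat. Qed.

Lemma tau_pow_1S (r : nat) (A : T) :
  tau_pow r.+2 1 A = tau_pow r.+1 1 A \oc tensm (idm L) (tau_on (down r A)).
Proof. by rewrite /= tensm_compl. Qed.

Lemma sphere_downK (n s : int) :
  exists v : iso (sphere T n s) (down 1 (sphere T n (s + 1))),
    iso_to v = sphere_down T n s.
Proof.
by exists (comp_iso (eq_iso (fun d => sphere T d.1 d.2) (sphere_downE n s))
             (inv_iso (sphere_mul T 0 (-1) n (s + 1)))).
Qed.

Lemma sphere_suspK (n s n' s' : int) (en : n' = n - 1) (es : s' = s + 1) :
  exists v : iso (sphere T n s) (susp (sphere T n' s')),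
    iso_to v = sphere_susp T en es.
Proof.
by exists (comp_iso
  (eq_iso (fun d => suspz d.1 (nu (suspz d.2 (tt_unit (Sp T)))))
     (sphere_suspE en es))
  (inv_iso (suspz_succ (- s') (nu (suspz (n' + s') (tt_unit (Sp T))))))).
Qed.

Section DownPi.
Variables (n : int) (A : T).

Lemma down_pi_comp (c : nat) (s s' : int) (e : s' = s + c%:Z) (B : T)
    (g : mor A B) (f : hpi n s' A) :
  down_pi e (g \oc f) = downm c g \oc down_pi e f.
Proof.
elim: c s e => [|c IH] s e /=; first by rewrite comp_assoc.
by rewrite IH tensm_compl comp_assoc.
Qed.

Lemma down_piD (c : nat) (s s' : int) (e : s' = s + c%:Z) (f g : hpi n s' A) :
  down_pi e (f + g) = down_pi e f + down_pi e g.
Proof.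
elim: c s e => [|c IH] s e /=; first by rewrite comp_addl.
by rewrite IH tensm_addr comp_addl.
Qed.

Lemma down_pi0r (c : nat) (s s' : int) (e : s' = s + c%:Z) :
  down_pi e (0 : hpi n s' A) = 0.
Proof. by apply: (addrI (down_pi e 0)); rewrite -down_piD !addr0. Qed.

(** Each layer of [down_pi] tensors with the invertible object $S^{0,-1}$ and precomposes with an
    isomorphism of spheres, hence is bijective. *)
Lemma down_pi_inj (c : nat) (s s' : int) (e : s' = s + c%:Z) :
  injective (@down_pi T c n s s' A e).
Proof.
elim: c s e => [|c IH] s e f g /=; first exact: iso_injr.
have [v <-] := sphere_downK n s => /iso_injr.
by move/(invertible_tens_inj sphere_invl)/IH.
Qed.

Lemma down_pi_surj (c : nat) (s s' : int) (e : s' = s + c%:Z)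
    (g : hpi n s (down c A)) : exists f : hpi n s' A, down_pi e f = g.
Proof.
elim: c s e g => [|c IH] s e g /=.
  by exists (g \oc iso_of (eq_iso (sphere T n) (down_pi0 e)));
    rewrite -comp_assoc iso_toK comp_idr.
have [v <-] := sphere_downK n s.
have [h hE] := invertible_tens_surj sphere_invl sphere_invr (g \oc iso_of v).
have [f fE] := IH _ (down_piS e) h.
by exists f; rewrite fE hE -comp_assoc iso_toK comp_idr.
Qed.

End DownPi.

Section SuspPi.
Variables (n s n' s' : int) (en : n' = n - 1) (es : s' = s + 1).

Lemma susp_pi_comp (A B : T) (g : mor A B) (f : hpi n' s' A) :
  susp_pi en es (g \oc f) = suspm g \oc susp_pi en es f.
Proof. by rewrite /susp_pi suspm_comp comp_assoc. Qed.

Lemma susp_pi0 (A : T) : susp_pi en es (0 : hpi n' s' A) = 0.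
Proof. by rewrite /susp_pi suspm0 comp0l. Qed.

Lemma susp_pi_inj (A : T) : injective (@susp_pi T n s n' s' A en es).
Proof.
by move=> f g; rewrite /susp_pi; have [v <-] := sphere_suspK en es
  => /iso_injr /suspm_inj.
Qed.

Lemma susp_pi_surj (A : T) (g : hpi n s (susp A)) :
  exists f : hpi n' s' A, susp_pi en es f = g.
Proof.
have [v vE] := sphere_suspK en es; have [f fE] := suspm_surj (g \oc iso_of v).
by exists f; rewrite /susp_pi fE -vE -comp_assoc iso_toK comp_idr.
Qed.

End SuspPi.

(** * Cycles and boundaries *)

Section Signature.
Variables (X : T) (Q : tau_quotients X).

Lemma quo1_dist : dist (tau_on X) (quo_in Q 1) (quo_bd Q 1).
Proof. by have := quo_dist Q 1; rewrite /= comp_idl. Qed.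

Lemma differential00 (r : nat) (n s n' s' : int) :
  n' = n - 1 -> s' = s + 1 + r%:Z ->
  @differential T X Q r n s n' s' 0 0.
Proof.
move=> en es; exists en, es, 0; split; last by rewrite comp0r.
by rewrite down_pi0r !comp0r susp_pi0.
Qed.

(** Both claims share one induction: the step for cycles needs 0 to be a boundary, and the step for
    boundaries needs 0 to be a cycle. *)
Lemma cycles_boundaries0 (r : nat) (n s : int) :
  @cycles T X Q r n s 0 /\ @boundaries T X Q r n s 0.
Proof.
rewrite /cycles /boundaries.
elim: r n s => [|[|r] IH] n s //; split=> /=.
  split; first exact: (IH n s).1.
  exists 0; split; last exact: (IH _ _).2.
  by apply: differential00; rewrite ?(down_piS (erefl (s + r.+2%:Z))).
exists 0, 0; rewrite subrr; split; [exact: (IH _ _).1| |exact: (IH _ _).2].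
apply: differential00; first by rewrite addrK.
by apply: down_piS; rewrite subrK.
Qed.

(* If x lifts to X/tau^(r+1), then its boundary lifts along tau^r to some g,
   so that tau g witnesses that d_(r+1) of x is represented by 0. *)
Lemma cycles_red (r : nat) (hr : (1 <= r)%N) (n s : int) (x : hpi n s (quo Q r)) :
  cycles r (quo_red Q hr \oc x).
Proof.
rewrite /cycles; case: r hr x => [//|r].
elim: r => [//|r IH] hr x.
have hS : (r.+1 <= r.+2)%N by [].
split.
  by rewrite -(quo_red_comp Q hS (ltn0Sn r)) -comp_assoc; exact: IH.
exists 0; split; last exact: (cycles_boundaries0 _ _ _).2.
have en : n - 1 = n - 1 by [].
have es := down_piS (erefl (s + r.+2%:Z)).
have [g gE] := susp_pi_surj en (erefl (s + 1)) (quo_bd Q r.+2 \oc x).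
have [a aE] := down_pi_surj es (tensm (idm L) (tau_on (down r X)) \oc g).
exists en, es, a; split.
  by rewrite aE (comp_assoc (tau_pow _ _ _)) -tau_pow_1S susp_pi_comp gE !comp_assoc quo_red_bd.
(* The class represented by [a] is zero: [a] is a $\tau$-multiple, and [quo_in Q 1] kills $\tau$ on
   whichever tensor factor it acts. *)
apply: (down_pi_inj (e := es)); rewrite down_pi0r down_pi_comp aE comp_assoc /=.
by rewrite -tensm_compl (downm_tau_on0 _ (dist_comp0 quo1_dist)) tensm0r comp0l.
Qed.

Lemma tau_pow_down_piS (r : nat) (n s s' : int) (e : s' = s + r.+1%:Z)
    (e' : s' = s + 1 + r%:Z) (a : hpi n s' X) :
  tau_pow r 0 X \oc down_pi e' a = 0 -> tau_pow r.+1 0 X \oc down_pi e a = 0.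
Proof.
move=> a0; rewrite tau_pow_S -comp_assoc /= (eq_irrelevance (down_piS e) e').
by rewrite [X in tau_on _ \oc X]comp_assoc -tensm_compl a0 tensm0r comp0l comp0r.
Qed.

(** The representative [a] of a value of $d_{r+2}$ has $\tau^r a$ equal to the boundary of [x], and
    $\tau$ kills that boundary because the maps are consecutive in a triangle. *)
Lemma differential_tau_torsion (r : nat) (n s n' s' : int)
    (e : s' = s + 1 + r.+1%:Z) (x : hpi n s (quo Q 1)) (y : hpi n' s' (quo Q 1)) :
  differential r.+1 x y ->
  exists a : hpi n' s' X,
    y = quo_in Q 1 \oc a /\ tau_pow r.+1 0 X \oc down_pi e a = 0.
Proof.
move=> [en [es [a [xE ->]]]]; exists a; split=> //.
rewrite (eq_irrelevance e es) tau_pow_S -comp_assoc.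
apply: (susp_pi_inj (en := en) (es := erefl (s + 1))).
by rewrite susp_pi0 susp_pi_comp -xE comp_assoc (dist_susp_comp0 quo1_dist) comp0l.
Qed.

(** By induction, a boundary is a value of the last differential plus an earlier boundary; the
    torsion lifts of the two summands are added. *)
Lemma boundaries_tau_torsion (r : nat) (n s s' : int) (e : s' = s + r%:Z)
    (y : hpi n s' (quo Q 1)) :
  boundaries r.+1 y ->
  exists a : hpi n s' X,
    y = quo_in Q 1 \oc a /\ tau_pow r 0 X \oc down_pi e a = 0.
Proof.
elim: r s e y => [|r IH] s e y.
  by move=> y0; exists 0; rewrite down_pi0r !comp0r.
(* The source of $d_{r+2}$ lies in weight $s'-(r+2)$, and its boundary one weight higher, which is
   [s]. *)
have sE : s = s' - r.+2%:Z + 1.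
  by rewrite e (PoszS r.+1) opprD !addrA !addrK.
move=> [x [z [_ xz yzB]]].
have [b [bE b0]] := IH _ (down_piS e) _ yzB.
have e' : s' = s' - r.+2%:Z + 1 + r.+1%:Z by rewrite -sE.
have [a [aE a0]] := differential_tau_torsion e' xz.
exists (a + b); split; first by rewrite comp_addr -bE -aE addrC subrK.
rewrite down_piD comp_addr (tau_pow_down_piS _ b0) addr0.
by move: e' a0; rewrite -sE => e' a0; rewrite (eq_irrelevance e e').
Qed.

(** The reduction factors through $X/\tau^c$, the third term of the triangle that starts with
    multiplication by $\tau^c$. *)
Lemma quo_red_mul0 (c i k : nat) (e : (c + i)%N = k) (m : nat) (h : (m <= k)%N) :
  (m <= c)%N -> quo_red Q h \oc quo_mul Q e = 0.
Proof.
move=> mc; have ck : (c <= k)%N by rewrite -e leq_addr.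
by rewrite -(quo_red_comp Q ck mc) -comp_assoc (dist_comp0 (quo_mul_dist Q e ck))
  comp0r.
Qed.

(** * Multiplication by powers of tau on homotopy groups of the quotients *)

Section TauMul.
Variables (n s : int) (i k : nat) (h : (i <= k)%N).
Implicit Types (b : hpi n (s + k%:Z - i%:Z) (quo Q i)).

Lemma tau_mulD b b' : tau_mul h (b + b') = tau_mul h b + tau_mul h b'.
Proof. by rewrite /tau_mul down_piD comp_addr. Qed.

Lemma tau_mul0 : tau_mul h (0 : hpi n (s + k%:Z - i%:Z) (quo Q i)) = 0.
Proof. by rewrite /tau_mul down_pi0r comp0r. Qed.

Lemma tau_mulB b b' : tau_mul h (b - b') = tau_mul h b - tau_mul h b'.
Proof.
by apply: (addIr (tau_mul h b')); rewrite -tau_mulD !subrK.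
Qed.

Lemma tau_mul_surj (h' : (k - i <= k)%N) (x : hpi n s (quo Q k)) :
  quo_red Q h' \oc x = 0 -> exists b, x = tau_mul h b.
Proof.
move=> x0; have [y <-] := dist_exact (quo_mul_dist Q (subnK h) h') x0.
by have [b <-] := down_pi_surj (tau_mul_deg s h) y; exists b.
Qed.

Lemma tau_mul_quo_in (a : hpi n (s + k%:Z - i%:Z) X) :
  tau_pow (k - i) 0 X \oc down_pi (tau_mul_deg s h) a = 0 ->
  tau_mul h (quo_in Q i \oc a) = 0.
Proof.
move=> a0; rewrite /tau_mul down_pi_comp comp_assoc quo_mul_in.
by rewrite -comp_assoc a0 comp0r.
Qed.

Lemma red_tau_mul0 b (m : nat) (h' : (m <= k)%N) :
  (m <= k - i)%N -> quo_red Q h' \oc tau_mul h b = 0.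
Proof. by move=> mk; rewrite /tau_mul comp_assoc quo_red_mul0 ?comp0l. Qed.

(** Reduction commutes with multiplication by $\tau^{k-i}$, so the reduction factors through that of
    [b] to $X/\tau$. This moves an element into the next smaller kernel of the induction. *)
Lemma red_tau_mul_divisible b (hi : (1 <= i)%N) (m : nat) (h' : (m <= k)%N) :
  m = (k - i + 1)%N -> quo_red Q hi \oc b = 0 -> quo_red Q h' \oc tau_mul h b = 0.
Proof.
move=> mE b0; rewrite /tau_mul comp_assoc.
by rewrite (quo_red_mul Q _ (esym mE) hi) -comp_assoc -down_pi_comp b0 down_pi0r
  comp0r.
Qed.

End TauMul.
End Signature.
End Synthetic.

(** * Generation *)

Section Span.
Variable M : zmodType.
Implicit Types S A : M -> Prop.

Lemma zspan_subgroup S : is_subgroup (zspan S).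
Proof.
split=> [H [H0 _] _ //|x y Sx Sy H sH SH].
by apply: sH.2; [exact: Sx|exact: Sy].
Qed.

Lemma zspan_mem S x : S x -> zspan S x.
Proof. by move=> Sx H _; apply. Qed.

Lemma zspanD S x y : zspan S x -> zspan S y -> zspan S (x + y).
Proof.
have [S0 SB] := zspan_subgroup S; move=> Sx Sy.
by rewrite -(opprK y) -(sub0r y); apply: (SB) => //; apply: SB.
Qed.

End Span.

Lemma zspan_image (M N : zmodType) (f : M -> N) (S : M -> Prop) (S' : N -> Prop)
    (x : M) :
  f 0 = 0 -> (forall x y, f (x - y) = f x - f y) ->
  (forall y, S y -> zspan S' (f y)) -> zspan S x -> zspan S' (f x).
Proof.
have [S0 SB] := zspan_subgroup S'; move=> f0 fB fS.
move=> /(_ (fun y => zspan S' (f y))); apply; last exact: fS.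
by split=> [|a b Sa Sb]; rewrite ?f0 ?fB //; apply: SB.
Qed.

(** The image under [f] of the span of [S] is itself a subgroup containing the image of [S]. *)
Lemma zspan_preimage (M N : zmodType) (f : M -> N) (S : M -> Prop) (y : N) :
  f 0 = 0 -> (forall x y, f (x - y) = f x - f y) ->
  zspan (fun z => exists2 x, S x & z = f x) y ->
  exists2 x, zspan S x & y = f x.
Proof.
move=> f0 fB /(_ (fun z => exists2 x, zspan S x & z = f x)).
apply=> [|_ [x Sx ->]]; last by exists x => //; exact: zspan_mem.
have [S0 SB] := zspan_subgroup S; split; first by exists 0.
by move=> _ _ [a Sa ->] [b Sb ->]; exists (a - b) => //; exact: SB.
Qed.

Section Generation.
Variables (T : synthetic_theory) (X : T) (Q : tau_quotients X).
Variables (n s : int) (k : nat).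
Variables (J : nat -> Type)
  (beta : forall i : nat, J i -> hpi n (s + k%:Z - i%:Z) (quo Q i)).
Arguments beta : clear implicits.

Definition lifts_generate (l : nat) : Prop :=
  forall (i : nat) (hi : (1 <= i)%N), (i <= l)%N ->
    generates_mod
      (@cycles T X Q i n (s + k%:Z - i%:Z))
      (@boundaries T X Q (k + 1 - i)%N n (s + k%:Z - i%:Z))
      (fun z => exists j : J i, z = quo_red Q hi \oc beta i j).

Definition tau_multiples (l : nat) (x : hpi n s (quo Q k)) : Prop :=
  exists (i : nat) (hik : (i <= k)%N) (j : J i),
    [/\ (1 <= i)%N, (i <= l)%N & x = tau_mul hik (beta i j)].

Lemma kernel_generated (l : nat) (hl : (l <= k)%N) (h : (k - l <= k)%N)
    (x : hpi n s (quo Q k)) :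
  lifts_generate l -> quo_red Q h \oc x = 0 -> zspan (tau_multiples l) x.
Proof.
elim: l hl h x => [|l IH] hl h x gen x0.
  have x00 : x = 0.
    move: h x0; rewrite subn0 => h.
    by rewrite quo_red_id comp_idl.
  by rewrite x00; exact: (zspan_subgroup _).1.
have [y yE] := tau_mul_surj hl x0.
have [_ /(_ _ (cycles_red (ltn0Sn l) y)) [w [wS]]] := gen l.+1 (ltn0Sn l) (leqnn _).
(* The boundary index exceeds by one the exponent of the power of $\tau$ that must kill the lift. *)
have -> : (k + 1 - l.+1 = (k - l.+1).+1)%N by rewrite addn1 subSn.
move=> /(boundaries_tau_torsion (tau_mul_deg s hl)) [a [aE a0]].
have [v vS vE] : exists2 v, zspan (fun b => exists j, b = beta l.+1 j) v
    & w = quo_red Q (ltn0Sn l) \oc v.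
  apply: zspan_preimage; [exact: comp0r|exact: compBr|].
  apply: wS; first exact: zspan_subgroup.
  by move=> _ [j ->]; apply: zspan_mem; exists (beta l.+1 j) => //; exists j.
have -> : x = tau_mul hl v + tau_mul hl (y - v - quo_in Q l.+1 \oc a).
  by rewrite !tau_mulB (tau_mul_quo_in Q a0) subr0 addrC subrK.
apply: zspanD.
  move: vS; apply: (zspan_image (f := @tau_mul T X Q _ _ hl n s)); [exact: tau_mul0|exact: tau_mulB|].
  by move=> _ [j ->]; apply: zspan_mem; exists l.+1, hl, j.
have incl z : tau_multiples l z -> zspan (tau_multiples l.+1) z.
  by move=> [i [hik [j [i1 il ->]]]]; apply: zspan_mem; exists i, hik, j;
    split=> //; exact: leqW.
apply: (zspan_image (f := id)) incl _ => //.
apply: (IH (ltnW hl) (leq_subr _ _)).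
  by move=> i hi il; apply: gen; exact: leqW.
have u0 : quo_red Q (ltn0Sn l) \oc (y - v - quo_in Q l.+1 \oc a) = 0.
  by rewrite !compBr comp_assoc quo_red_in -vE aE subrr.
(* Here $k-(l+1)+1=k-l$, the exponent at which the induction hypothesis applies. *)
by apply: red_tau_mul_divisible u0; rewrite addn1 subnSK.
Qed.

Lemma kernel_generates (m : nat) (hmk : (m <= k)%N) :
  lifts_generate (k - m) ->
  generates (fun x : hpi n s (quo Q k) => quo_red Q hmk \oc x = 0)
    (tau_multiples (k - m)).
Proof.
move=> gen x; split.
  move=> x0; apply: (kernel_generated (leq_subr m k) (h := leq_subr _ _)) => //.
  by move: (leq_subr _ _); rewrite subKn // => h; rewrite (bool_irrelevance h hmk).
move=> /(_ (fun x => quo_red Q hmk \oc x = 0)).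
apply; first split; first exact: comp0r.
  by move=> a b a0 b0; rewrite compBr a0 b0 subrr.
(* Conversely, $i\le k-m$ means $m\le k-i$, so multiples of $\tau^{k-i}$ vanish in $X/\tau^m$. *)
move=> _ [i [hik [j [_ il ->]]]]; apply: red_tau_mul0.
by rewrite -(subKn hmk) leq_sub2l.
Qed.

End Generation.

Theorem theorem2p23 (T : synthetic_theory) (X : T) (Q : tau_quotients X)
    (n s : int) (k : nat) (hk : (1 <= k)%N) :
  (forall (J : nat -> Type)
      (beta : forall i : nat, J i -> hpi n (s + k%:Z - i%:Z) (quo Q i)),
    (forall (i : nat) (hi : (1 <= i)%N), (i <= k)%N ->
       generates_mod
         (@cycles T X Q i n (s + k%:Z - i%:Z))
         (@boundaries T X Q (k + 1 - i)%N n (s + k%:Z - i%:Z))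
         (fun z => exists j : J i, z = quo_red Q hi \oc beta i j)) ->
    generates (fun _ : hpi n s (quo Q k) => True)
      (fun x => exists (i : nat) (hik : (i <= k)%N) (j : J i),
         (1 <= i)%N /\ x = tau_mul hik (beta i j)))
  /\
  (forall (m : nat) (hm : (1 <= m)%N) (hmk : (m <= k)%N)
      (J : nat -> Type)
      (beta : forall i : nat, J i -> hpi n (s + k%:Z - i%:Z) (quo Q i)),
    (forall (i : nat) (hi : (1 <= i)%N), (i <= k - m)%N ->
       generates_mod
         (@cycles T X Q i n (s + k%:Z - i%:Z))
         (@boundaries T X Q (k + 1 - i)%N n (s + k%:Z - i%:Z))
         (fun z => exists j : J i, z = quo_red Q hi \oc beta i j)) ->
    generates (fun x : hpi n s (quo Q k) => quo_red Q hmk \oc x = 0)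
      (fun x => exists (i : nat) (hik : (i <= k)%N) (j : J i),
         [/\ (1 <= i)%N, (i <= k - m)%N & x = tau_mul hik (beta i j)])).
Proof.
split=> [J beta gen | m hm hmk J beta]; last exact: kernel_generates.
(* Part (1) is the kernel statement for $m=0$, because $X/\tau^0$ is zero: $\tau^0$ is the identity,
   so the other two maps of its triangle vanish, and by exactness the identity of $X/\tau^0$ factors
   through one of them. *)
have gen0 : lifts_generate beta (k - 0) by rewrite subn0.
have d := quo_dist Q 0.
have in0 : quo_in Q 0 = 0 by rewrite -(dist_comp0 d) comp_idr.
have bd0 : quo_bd Q 0 = 0.
  by rewrite -(dist_susp_comp0 d) suspm_id comp_idl.
have id0 : idm (quo Q 0) = 0.
  have e : quo_bd Q 0 \oc idm (quo Q 0) = 0 by rewrite bd0 comp0l.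
  move/dist_rotate: d => d; have [a <-] := dist_exact d e.
  by rewrite in0 comp0l.
move=> x; split=> // _.
have /(kernel_generates (leq0n k) gen0) : quo_red Q (leq0n k) \oc x = 0.
  by rewrite -(comp_idl (quo_red _ _)) id0 !comp0l.
move=> xS H sH SH; apply: xS => // y [i [hik [j [i1 _ ->]]]].
by apply: SH; exists i, hik, j.
Qed.
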